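(* For integers $d\ge3$ define three quantities as follows. (a) $\mu_d=x\sqrt{2/d}$, where $x\ge2\sqrt{d-1}$ is the unique solution of $$\frac{2-d}{d}-\log\left(\frac{dz^2}{2}\right)+\frac{d-1}{2}z^2-\frac{2}{d^2z^2}=0,\qquad z=z(x)=\frac{1}{(d-1)\sqrt{2d}}\left(x-\sqrt{x^2-4(d-1)}\right).$$ (b) $\Lambda^*_{\mathrm{sph},d}=\inf\{\lambda\ge0:\ L_d(\lambda)>\mu_d\}$, where $$L_d(\lambda)=\max_{m\in[0,1]}m^d\left(\lambda+\sqrt{\frac{2d}{d-1}}\sqrt{M(1+M)}\right),\qquad M=M(m)=(d-1)\frac{1-m^2}{m^2}.$$ (c) $\lambda^*_{\mathrm{sph},d}$ is the supremum of all $\lambda^*$ for which $\frac{(\lambda^* )^2}{2}\frac{t^d}{1+t^d}\le-\frac12\log(1-t^2)$ for all $t\in[0,1)$. Then, as $d\to\infty$, $$\mu_d^2=2\log d+2\log\log d+2+o(1),$$ $$(\Lambda^*_{\mathrm{sph},d})^2=2\log d+2\log\log d+o(1),$$ $$(\lambda^*_{\mathrm{sph},d})^2=2\log d+2\log\log d+2-4\log2+o(1).$$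
   Context: In (b), the expression being maximized is interpreted at $m=0$ by continuity (its value there is $0$). $\log$ is the natural logarithm. The existence and uniqueness of the solution $x$ in (a) may be taken as known. *)

(* Defs.v *)
From Stdlib Require Import Reals ClassicalEpsilon.
From Coquelicot Require Import Coquelicot.
Open Scope R_scope.

(* All definitions are total in [d : nat]; they are meaningful for d >= 3. *)

Definition z_of (d : nat) (x : R) : R :=
  1 / ((INR d - 1) * sqrt (2 * INR d)) * (x - sqrt (x ^ 2 - 4 * (INR d - 1))).

Definition mu_equation (d : nat) (x : R) : Prop :=
  let z := z_of d x in
  (2 - INR d) / INR d - ln (INR d * z ^ 2 / 2) + (INR d - 1) / 2 * z ^ 2
    - 2 / (INR d ^ 2 * z ^ 2) = 0.

(* The solution exists and is unique for every d >= 3, so that there the value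
   of [epsilon] is this solution. *)
Definition mu_root (d : nat) : R :=
  epsilon (inhabits 0)
    (fun x => 2 * sqrt (INR d - 1) <= x /\ mu_equation d x).

Definition mu (d : nat) : R := mu_root d * sqrt (2 / INR d).

Definition is_maximum (E : R -> Prop) (y : R) : Prop :=
  E y /\ is_upper_bound E y.

(* The greatest element of [E]; unspecified when [E] has none. *)
Definition maximum (E : R -> Prop) : R := epsilon (inhabits 0) (is_maximum E).

Definition M_of (d : nat) (m : R) : R := (INR d - 1) * ((1 - m ^ 2) / m ^ 2).

(* At m = 0 the factor [m ^ d] is 0, so the (total) expression takes the value
   0, which is also its limit as m -> 0+ because d >= 3. *)
Definition L_objective (d : nat) (lam m : R) : R :=
  m ^ d * (lam + sqrt (2 * INR d / (INR d - 1))
                 * sqrt (M_of d m * (1 + M_of d m))).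

Definition L (d : nat) (lam : R) : R :=
  maximum (fun y => exists m, 0 <= m <= 1 /\ y = L_objective d lam m).

(* For d >= 3 the two sets below are nonempty and bounded on the relevant side,
   so that the [Rbar]-valued bounds are finite and [real] loses nothing. *)

Definition Lambda_sph (d : nat) : R :=
  real (Glb_Rbar (fun lam => 0 <= lam /\ L d lam > mu d)).

Definition lambda_sph (d : nat) : R :=
  real (Lub_Rbar (fun lam => forall t, 0 <= t < 1 ->
    lam ^ 2 / 2 * (t ^ d / (1 + t ^ d)) <= - (1 / 2) * ln (1 - t ^ 2))).

(* Main.v *)
Require Import Defs.
From Stdlib Require Import Reals Ranalysis5 Lra Lia Psatz ClassicalEpsilon.
From Coquelicot Require Import Coquelicot.
Open Scope R_scope.

(** Write [n = d - 1] and [l = log d].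

    (a) With [x = sqrt n (q + 1/q)], [q >= 1] and [s = q^2], the equation becomes
    [2/d - 1 + log n + log s + 1/(d s) - (n/d) s = 0], and
    [mu^2 = 2 (n/d) (s + 2 + 1/s)].  Any root satisfies [s >= log n - 1], hence
    [s -> oo] and [l / s -> 1], so that [s (n/d) = l + log l - 1 + o(1)].

    (b) With [v = 1 - m^2] the objective is
    [m^d lam + m^(d-2) sqrt (2 d v (1 + (d-2) v))].  Its maximum is
    [lam + (1 + o(1)) / lam] as [lam -> oo], so [L_d(lam) = mu_d] forces
    [lam^2 = mu_d^2 - 2 + o(1)].

    (c) The square of the threshold is the infimum over [t] of
    [- log (1 - t^2) (1 + t^(-d))].  With [1 - t^2 = c/d] this is about
    [(l - log c) (2 + c/2)], which is minimized near [c = 4/l]. *)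

(** * Limits along sequences tending to infinity, and the slow growth of the logarithm *)

Lemma is_lim_seq_comp_p (f : R -> R) (u : nat -> R) (l : Rbar) :
  is_lim f p_infty l -> is_lim_seq u p_infty -> is_lim_seq (fun n => f (u n)) l.
Proof. intros Hf Hu. exact (filterlim_comp _ _ _ u f _ _ _ Hu Hf). Qed.

Lemma is_lim_seq_ln_INR : is_lim_seq (fun d => ln (INR d)) p_infty.
Proof. exact (is_lim_seq_comp_p _ _ _ is_lim_ln_p is_lim_seq_INR). Qed.

Lemma is_lim_seq_inv_p (u : nat -> R) :
  is_lim_seq u p_infty -> is_lim_seq (fun n => / u n) 0.
Proof. intros Hu. apply (is_lim_seq_inv u p_infty Hu); discriminate. Qed.

Lemma eventually_ge_lim_p (u : nat -> R) (C : R) :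
  is_lim_seq u p_infty -> eventually (fun n => C < u n).
Proof. intros Hu. apply (Hu (fun x => C < x)). now exists C. Qed.

Lemma ln_le_eventually (e : R) : 0 < e ->
  Rbar_locally p_infty (fun y => ln y <= e * y).
Proof.
  intros He.
  destruct (is_lim_div_ln_p (fun y => Rabs (y - 0) < e)) as [M HM].
  { exists (mkposreal e He). intros y Hy. exact Hy. }
  exists (Rmax M 1). intros y Hy.
  assert (H1 := Rmax_l M 1). assert (H2 := Rmax_r M 1).
  assert (H := HM y ltac:(lra)). apply Rabs_def2 in H.
  assert (ln y / y < e) by lra.
  replace (ln y) with (ln y / y * y) by (field; lra).
  apply Rmult_le_compat_r; lra.
Qed.

Lemma ln_le_eventually_seq (u : nat -> R) (e : R) : 0 < e ->
  is_lim_seq u p_infty -> eventually (fun n => ln (u n) <= e * u n).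
Proof. intros He Hu. exact (Hu _ (ln_le_eventually e He)). Qed.

Lemma is_lim_seq_squeeze_eps (u v : nat -> R) :
  (forall e, 0 < e -> eventually (fun n => v n - e <= u n <= v n + e)) ->
  is_lim_seq (fun n => u n - v n) 0.
Proof.
  intros H. apply is_lim_seq_spec. intros e.
  assert (He : 0 < e / 2) by (pose proof (cond_pos e); lra).
  destruct (H _ He) as [N HN]. exists N. intros n Hn.
  specialize (HN n Hn). pose proof (cond_pos e).
  apply Rabs_def1; lra.
Qed.

(** * The quantity [mu] *)

Definition mu_residual (D s : R) : R :=
  2 / D - 1 + ln (D - 1) + ln s + 1 / (D * s) - (D - 1) / D * s.

Lemma INR_ge_3 (d : nat) : (3 <= d)%nat -> 3 <= INR d.
Proof. intros H. apply le_INR in H. simpl in H. lra. Qed.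

(** Because [q >= 1], the inner root is [sqrt n * (q - / q)], so the difference in [z_of] collapses
    to [2 * sqrt n / q]. *)
Lemma z_of_param (d : nat) (q : R) : (3 <= d)%nat -> 1 <= q ->
  z_of d (sqrt (INR d - 1) * (q + / q)) ^ 2
    = 2 / ((INR d - 1) * INR d * q ^ 2).
Proof.
  intros Hd Hq. apply INR_ge_3 in Hd. unfold z_of.
  set (D := INR d) in *.
  assert (Hn : 0 < sqrt (D - 1)) by (apply sqrt_lt_R0; lra).
  assert (Hnn : sqrt (D - 1) * sqrt (D - 1) = D - 1) by (apply sqrt_sqrt; lra).
  assert (Hs2 : 0 < sqrt (2 * D)) by (apply sqrt_lt_R0; lra).
  assert (Hs22 : sqrt (2 * D) * sqrt (2 * D) = 2 * D) by (apply sqrt_sqrt; lra).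
  assert (Hqi : / q <= 1) by (rewrite <- Rinv_1; apply Rinv_le_contravar; lra).
  assert (E : sqrt ((sqrt (D - 1) * (q + / q)) ^ 2 - 4 * (D - 1))
              = sqrt (D - 1) * (q - / q)).
  { rewrite <- (sqrt_pow2 (sqrt (D - 1) * (q - / q))).
    - f_equal. rewrite <- Hnn at 2. field. lra.
    - apply Rmult_le_pos; lra. }
  rewrite E.
  replace (sqrt (D - 1) * (q + / q) - sqrt (D - 1) * (q - / q))
    with (2 * sqrt (D - 1) / q) by (field; lra).
  replace ((1 / ((D - 1) * sqrt (2 * D)) * (2 * sqrt (D - 1) / q)) ^ 2)
    with (4 * (sqrt (D - 1) * sqrt (D - 1))
            / ((D - 1) ^ 2 * (sqrt (2 * D) * sqrt (2 * D)) * q ^ 2)).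
  - rewrite Hnn, Hs22. field. lra.
  - field. lra.
Qed.

(* The parameter [q ^ 2] equals [2 / (d (d - 1) z ^ 2)]. *)
Lemma mu_equation_param (d : nat) (q : R) : (3 <= d)%nat -> 1 <= q ->
  mu_equation d (sqrt (INR d - 1) * (q + / q))
    <-> mu_residual (INR d) (q ^ 2) = 0.
Proof.
  intros Hd Hq. unfold mu_equation, mu_residual. cbv zeta.
  rewrite (z_of_param d q Hd Hq). apply INR_ge_3 in Hd.
  set (D := INR d) in *.
  assert (Hq2 : 0 < q ^ 2) by nra.
  replace (D * (2 / ((D - 1) * D * q ^ 2)) / 2) with (/ ((D - 1) * q ^ 2))
    by (field; lra).
  rewrite ln_Rinv by nra. rewrite ln_mult by lra.
  replace ((2 - D) / D - - (ln (D - 1) + ln (q ^ 2))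
    + (D - 1) / 2 * (2 / ((D - 1) * D * q ^ 2))
    - 2 / (D ^ 2 * (2 / ((D - 1) * D * q ^ 2))))
   with (2 / D - 1 + ln (D - 1) + ln (q ^ 2) + 1 / (D * q ^ 2)
         - (D - 1) / D * q ^ 2); [tauto | field; lra].
Qed.

(** Take for [q] the larger root of [q^2 - r q + 1 = 0], where [r = x / sqrt n >= 2]. *)
Lemma mu_root_param (n x : R) : 0 < n -> 2 * sqrt n <= x ->
  exists q, 1 <= q /\ x = sqrt n * (q + / q).
Proof.
  intros Hn Hx.
  assert (Hs : 0 < sqrt n) by (apply sqrt_lt_R0; lra).
  set (r := x / sqrt n).
  assert (Hr : 2 <= r) by (apply Rle_div_r; lra).
  assert (Hxr : x = sqrt n * r) by (unfold r; field; lra).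
  assert (H0 : 0 <= sqrt (r ^ 2 - 4)) by apply sqrt_pos.
  assert (H1 : sqrt (r ^ 2 - 4) * sqrt (r ^ 2 - 4) = r ^ 2 - 4)
    by (apply sqrt_sqrt; nra).
  exists ((r + sqrt (r ^ 2 - 4)) / 2). split; [lra|].
  rewrite Hxr. f_equal.
  apply Rmult_eq_reg_r with ((r + sqrt (r ^ 2 - 4)) / 2); [|lra].
  rewrite Rmult_plus_distr_r, Rinv_l by lra. nra.
Qed.

(** Intermediate value theorem on [[1, D - 1]]: the residual is [ln (D - 1) - 2 + 4 / D > 0] at the
    left end, and at the right end the linear term beats [2 * ln (D - 1)]. *)
Lemma mu_residual_root (D : R) :
  2 < ln (D - 1) -> ln (D - 1) <= / 9 * (D - 1) ->
  exists s, 1 <= s /\ mu_residual D s = 0.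
Proof.
  intros H1 H2.
  assert (HD : 18 < D - 1) by lra.
  assert (HDi : 0 < / D) by (apply Rinv_0_lt_compat; lra).
  destruct (IVT_interv (fun s => - mu_residual D s) 1 (D - 1)) as [s [Hs Es]].
  - intros s Hs. apply continuity_pt_opp.
    apply derivable_continuous_pt, ex_derive_Reals_0.
    unfold mu_residual. auto_derive. repeat split; nra.
  - lra.
  - unfold mu_residual. rewrite ln_1.
    replace (- (2 / D - 1 + ln (D - 1) + 0 + 1 / (D * 1) - (D - 1) / D * 1))
      with (2 - ln (D - 1) - 4 * / D) by (field; lra). lra.
  - unfold mu_residual.
    assert (E : (D - 1) / D = 1 - / D) by (field; lra).
    assert (0 < 1 / (D * (D - 1)) <= 1).
    { split; [apply Rdiv_lt_0_compat; nra|]. apply Rle_div_l; nra. }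
    assert (H4 : 2 / D = 2 * / D) by (field; lra).
    assert (H5 : / D * D = 1) by (field; lra).
    rewrite E, H4. nra.
  - exists s. split; lra.
Qed.

(** [epsilon] satisfies its predicate once some solution exists; existence for all large [d] is
    enough for the limits. *)
Lemma mu_root_exists :
  eventually (fun d => 2 * sqrt (INR d - 1) <= mu_root d
                       /\ mu_equation d (mu_root d)).
Proof.
  assert (Hp : is_lim_seq (fun d => INR d - 1) p_infty).
  { apply is_lim_seq_minus with p_infty 1;
      [apply is_lim_seq_INR | apply is_lim_seq_const | reflexivity]. }
  assert (H1 := eventually_ge_lim_p _ 2 (is_lim_seq_comp_p _ _ _ is_lim_ln_p Hp)).
  assert (H2 := ln_le_eventually_seq _ (/ 9) ltac:(lra) Hp).
  assert (H3 : eventually (fun d => (3 <= d)%nat)) by (exists 3%nat; auto).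
  generalize (filter_and _ _ H3 (filter_and _ _ H1 H2)).
  apply filter_imp. intros d [Hd [Ha Hb]].
  unfold mu_root. apply epsilon_spec.
  destruct (mu_residual_root _ Ha Hb) as [s [Hs Es]].
  assert (Hq : 1 <= sqrt s) by (rewrite <- sqrt_1; apply sqrt_le_1; lra).
  assert (0 <= sqrt (INR d - 1)) by apply sqrt_pos.
  exists (sqrt (INR d - 1) * (sqrt s + / sqrt s)). split.
  - rewrite Rmult_comm. apply Rmult_le_compat_l; [lra|].
    assert (sqrt s * / sqrt s = 1) by (field; lra).
    assert (0 < / sqrt s) by (apply Rinv_0_lt_compat; lra).
    nra.
  - apply mu_equation_param; auto. rewrite pow2_sqrt; [exact Es | lra].
Qed.

(** Collects the values [s = q^2] into one sequence, to which limit theorems apply; small [d] get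
    the dummy value [0]. *)
Lemma mu_param :
  exists s : nat -> R, eventually (fun d =>
    3 <= INR d /\ 1 <= s d /\ mu_residual (INR d) (s d) = 0 /\ 0 <= mu d
    /\ mu d ^ 2 = 2 * ((INR d - 1) / INR d) * (s d + 2 + / s d)).
Proof.
  destruct mu_root_exists as [N HN].
  assert (H : forall d, exists s, (max N 3 <= d)%nat ->
    3 <= INR d /\ 1 <= s /\ mu_residual (INR d) s = 0 /\ 0 <= mu d
    /\ mu d ^ 2 = 2 * ((INR d - 1) / INR d) * (s + 2 + / s)).
  { intros d. destruct (Compare_dec.le_dec (max N 3) d) as [Hd|Hd];
      [|exists 0; intros; contradiction].
    destruct (HN d) as [Hx Ex]; [lia|].
    assert (Hd3 : (3 <= d)%nat) by lia.
    assert (HD := INR_ge_3 d Hd3).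
    assert (Hn : 0 < INR d - 1) by lra.
    destruct (mu_root_param _ _ Hn Hx) as [q [Hq Eq]].
    exists (q ^ 2). intros _.
    rewrite Eq in Ex. apply mu_equation_param in Ex; auto.
    repeat split; auto.
    - nra.
    - unfold mu. apply Rmult_le_pos; [|apply sqrt_pos].
      assert (0 <= sqrt (INR d - 1)) by apply sqrt_pos. lra.
    - unfold mu. rewrite Eq, !Rpow_mult_distr, !pow2_sqrt.
      + field. lra.
      + apply Rlt_le, Rdiv_lt_0_compat; lra.
      + lra. }
  exists (fun d => proj1_sig (constructive_indefinite_description _ (H d))).
  exists (max N 3). intros d. apply proj2_sig.
Qed.

Lemma is_lim_seq_ln_pred :
  is_lim_seq (fun d => ln (INR d - 1) - ln (INR d)) 0.
Proof.
  apply is_lim_seq_ext_loc with (fun d => ln (1 - / INR d)).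
  - exists 2%nat. intros d Hd. apply le_INR in Hd. simpl in Hd.
    rewrite <- ln_div by lra. f_equal. field. lra.
  - replace 0 with (ln 1) by apply ln_1.
    apply is_lim_seq_continuous.
    + apply derivable_continuous_pt, ex_derive_Reals_0.
      auto_derive. lra.
    + replace (Finite 1) with (Finite (1 - 0)) by (f_equal; ring).
      apply is_lim_seq_minus'; [apply is_lim_seq_const|].
      apply is_lim_seq_inv_p, is_lim_seq_INR.
Qed.

(** Decomposes sequence and limit in parallel, so the limit has to be spelled in the shape of the
    sequence, as [1 - 0] for [1 - / INR d]; atomic limits are closed by hypotheses. *)
Ltac lim_seq_arith :=
  lazymatch goal with
  | |- is_lim_seq (fun d => @?f d - @?g d) (Finite (?a - ?b)) =>
      first [assumption | apply (is_lim_seq_minus' f g a b); lim_seq_arith]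
  | |- is_lim_seq (fun d => @?f d + @?g d) (Finite (?a + ?b)) =>
      apply (is_lim_seq_plus' f g a b); lim_seq_arith
  | |- is_lim_seq (fun d => @?f d * @?g d) (Finite (?a * ?b)) =>
      apply (is_lim_seq_mult' f g a b); lim_seq_arith
  | |- is_lim_seq (fun _ => ?c) _ => apply is_lim_seq_const
  | |- _ => assumption
  end.

Lemma mu_asymptotics :
  is_lim_seq (fun d : nat =>
    mu d ^ 2 - (2 * ln (INR d) + 2 * ln (ln (INR d)) + 2)) 0
  /\ eventually (fun d => 0 <= mu d).
Proof.
  destruct mu_param as [s Hs]. split;
    [|revert Hs; apply filter_imp; intros d Hd; apply Hd].
  assert (HL := is_lim_seq_ln_INR). assert (HP := is_lim_seq_ln_pred).
  assert (HI := is_lim_seq_inv_p _ is_lim_seq_INR).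
  assert (Hl1 := eventually_ge_lim_p _ 1 HL).
  (* As [ln s >= 0], the vanishing residual gives [s >= (n/d) s >= ln n - 1]. *)
  assert (Sp : is_lim_seq s p_infty).
  { apply is_lim_seq_le_p_loc with (fun d => (ln (INR d - 1) - ln (INR d)) + (ln (INR d) - 1)).
    - revert Hs. apply filter_imp. intros d [HD [H1 [H2 _]]].
      unfold mu_residual in H2.
      assert (0 <= ln (s d)).
      { destruct H1 as [H1|H1]; [|rewrite <- H1, ln_1; lra].
        rewrite <- ln_1. apply Rlt_le, ln_increasing; lra. }
      assert (0 < / INR d) by (apply Rinv_0_lt_compat; lra).
      assert (0 < 1 / (INR d * s d)) by (apply Rdiv_lt_0_compat; nra).
      assert (E : (INR d - 1) / INR d = 1 - / INR d) by (field; lra).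
      rewrite E in H2. unfold Rdiv in H2 at 1. nra.
    - apply is_lim_seq_plus with 0 p_infty; auto; [|reflexivity].
      apply is_lim_seq_minus with p_infty 1; auto;
        [apply is_lim_seq_const | reflexivity]. }
  assert (SI := is_lim_seq_inv_p _ Sp).
  assert (SL := is_lim_seq_comp_p _ _ _ is_lim_div_ln_p Sp).
  simpl in SL.
  (* Solve the residual equation for [ln d] and divide by [s]. *)
  assert (R1 : is_lim_seq (fun d => ln (INR d) / s d) 1).
  { apply is_lim_seq_ext_loc with (fun d =>
      (1 - / INR d) - ln (s d) / s d
      + (1 - 2 * / INR d - / INR d * / s d) * / s d
      - (ln (INR d - 1) - ln (INR d)) * / s d).
    - revert Hs. apply filter_imp. intros d [HD [H1 [H2 _]]].
      unfold mu_residual in H2.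
      (* Adding a multiple of the residual, which is zero, turns the claim into an identity for
         [field]. *)
      replace (ln (INR d)) with (ln (INR d) + (2 / INR d - 1 + ln (INR d - 1) + ln (s d) + 1 / (INR d * s d) -
     (INR d - 1) / INR d * s d) * -1) at 2 by (rewrite H2; ring).
      field. lra.
    - replace (Finite 1) with (Finite
        ((1 - 0) - 0 + (1 - 2 * 0 - 0 * 0) * 0 - 0 * 0)) by (f_equal; ring).
      lim_seq_arith. }
  assert (R2 : is_lim_seq (fun d => ln (ln (INR d) / s d)) 0).
  { rewrite <- ln_1. apply is_lim_seq_continuous; auto.
    apply derivable_continuous_pt, ex_derive_Reals_0. auto_derive. lra. }
  (* The residual equation eliminates [(n/d) s] from [mu^2]. The constants [-2], [4] and [-2]
     cancel, and every remaining term tends to 0. *)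
  apply is_lim_seq_ext_loc with (fun d =>
    2 * (ln (INR d - 1) - ln (INR d)) - 2 * ln (ln (INR d) / s d)
    + (4 * / INR d + 2 * (/ INR d * / s d)) - 4 * / INR d
    + 2 * ((1 - / INR d) * / s d)).
  - generalize (filter_and _ _ Hl1 Hs). apply filter_imp.
    intros d [Hl [HD [H1 [H2 [_ H3]]]]]. rewrite H3. unfold mu_residual in H2.
    rewrite ln_div by lra.
    replace (ln (s d)) with (ln (s d) - (2 / INR d - 1 + ln (INR d - 1) + ln (s d) + 1 / (INR d * s d) -
     (INR d - 1) / INR d * s d)) by (rewrite H2; ring).
    field. lra.
  - replace (Finite 0) with (Finite (2 * 0 - 2 * 0 + (4 * 0 + 2 * (0 * 0))
      - 4 * 0 + 2 * ((1 - 0) * 0))) by (f_equal; ring).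
    lim_seq_arith.
Qed.

(** * The threshold [Lambda_sph] *)

(** With [v = 1 - m^2] one has [M (1 + M) = (d-1) v (1 + (d-2) v) / m^4]. Pulling [m^2] out of the
    root removes the singularity at 0, where both sides vanish since [d - 2 >= 1]. *)
Lemma L_objective_eq (d : nat) (lam m : R) : (3 <= d)%nat -> 0 <= m <= 1 ->
  L_objective d lam m = m ^ d * lam + m ^ (d - 2)
    * sqrt (2 * INR d * ((1 - m ^ 2) * (1 + (INR d - 2) * (1 - m ^ 2)))).
Proof.
  intros Hd Hm. unfold L_objective, M_of.
  assert (HD := INR_ge_3 d Hd). set (D := INR d) in *.
  destruct (Req_dec m 0) as [->|Hm0].
  { rewrite !pow_i by lia. ring. }
  assert (Hm2 : 0 < m ^ 2) by nra.
  assert (Hv : 0 <= 1 - m ^ 2) by nra.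
  set (v := 1 - m ^ 2) in *.
  rewrite <- sqrt_mult_alt by (apply Rlt_le, Rdiv_lt_0_compat; lra).
  replace (2 * D / (D - 1) * ((D - 1) * (v / m ^ 2) * (1 + (D - 1) * (v / m ^ 2))))
    with (2 * D * (v * (1 + (D - 2) * v)) / (m ^ 2) ^ 2)
    by (unfold v; field; lra).
  rewrite sqrt_div_alt by nra. rewrite sqrt_pow2 by lra.
  replace (m ^ d) with (m ^ 2 * m ^ (d - 2)) by (rewrite <- pow_add; f_equal; lia).
  field. lra.
Qed.

(** The form without singularity is continuous on [[0, 1]], so the extreme value theorem supplies
    the witness for [epsilon]. *)
Lemma L_is_maximum (d : nat) (lam : R) : (3 <= d)%nat ->
  is_maximum (fun y => exists m, 0 <= m <= 1 /\ y = L_objective d lam m) (L d lam).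
Proof.
  intros Hd. unfold L, maximum. apply epsilon_spec.
  destruct (continuity_ab_maj (fun m => m ^ d * lam + m ^ (d - 2)
    * sqrt (2 * INR d * ((1 - m ^ 2) * (1 + (INR d - 2) * (1 - m ^ 2))))) 0 1)
    as [m [Hmax Hm]]; [lra| |].
  - intros c _. apply continuity_pt_filterlim.
    set (r := fun m : R =>
      sqrt (2 * INR d * ((1 - m ^ 2) * (1 + (INR d - 2) * (1 - m ^ 2))))).
    refine (continuous_plus (K := R_AbsRing) (V := R_NormedModule)
      (fun m : R => m ^ d * lam) (fun m => m ^ (d - 2) * r m) c _ _).
    { apply @ex_derive_continuous; auto_derive; exact I. }
    (* The root is handled by continuity alone, being not differentiable at [m = 1]. *)
    refine (continuous_mult (K := R_AbsRing) (fun m : R => m ^ (d - 2)) r c _ _).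
    { apply @ex_derive_continuous; auto_derive; exact I. }
    refine (continuous_comp (fun m : R => 2 * INR d
      * ((1 - m ^ 2) * (1 + (INR d - 2) * (1 - m ^ 2)))) sqrt c _
      (continuous_sqrt _)).
    apply @ex_derive_continuous; auto_derive; exact I.
  - exists (L_objective d lam m). split; [exists m; auto|].
    intros y [m' [Hm' ->]]. rewrite !L_objective_eq by auto. auto.
Qed.

Lemma L_le (d : nat) (lam b : R) : (3 <= d)%nat ->
  (forall m, 0 <= m <= 1 -> L_objective d lam m <= b) -> L d lam <= b.
Proof.
  intros Hd H. destruct (L_is_maximum d lam Hd) as [[m [Hm ->]] _]. auto.
Qed.

Lemma L_ge (d : nat) (lam m : R) : (3 <= d)%nat -> 0 <= m <= 1 ->
  L_objective d lam m <= L d lam.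
Proof.
  intros Hd Hm. destruct (L_is_maximum d lam Hd) as [_ H]. apply H. eauto.
Qed.

Lemma L_increasing (d : nat) (a b : R) : (3 <= d)%nat -> a <= b -> L d a <= L d b.
Proof.
  intros Hd Hab. apply L_le; auto. intros m Hm.
  apply Rle_trans with (L_objective d b m); [|now apply L_ge].
  unfold L_objective. apply Rmult_le_compat_l; [apply pow_le|]; lra.
Qed.

Lemma Bernoulli_sub (n : nat) (u : R) : 0 <= u <= 1 -> 1 - INR n * u <= (1 - u) ^ n.
Proof.
  intros Hu. induction n as [|n IH]; [simpl; lra|].
  rewrite S_INR. simpl. assert (0 <= INR n) by apply pos_INR.
  assert ((1 - INR n * u) * (1 - u) <= (1 - u) ^ n * (1 - u))
    by (apply Rmult_le_compat_r; lra).
  nra.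
Qed.

(* The point [m = 1 - 1/(d lam^2)] is where [lam m^d] and the square root
   balance to leading order. *)
Lemma L_lower (d : nat) (lam : R) : (3 <= d)%nat -> 1 <= lam ->
  lam + (1 - 4 / lam ^ 2) / lam <= L d lam.
Proof.
  intros Hd Hlam. assert (HD := INR_ge_3 d Hd).
  set (q := / lam ^ 2). set (u := q / INR d).
  assert (Hq : 0 < q <= 1).
  { unfold q. split; [apply Rinv_0_lt_compat; nra|].
    rewrite <- Rinv_1. apply Rinv_le_contravar; nra. }
  assert (Hu : 0 < u) by (apply Rdiv_lt_0_compat; lra).
  assert (HDu : INR d * u = q) by (unfold u; field; lra).
  assert (Huq : 3 * u <= q) by nra.
  assert (Hm : 0 <= 1 - u <= 1) by lra.
  apply Rle_trans with (2 := L_ge d lam (1 - u) Hd Hm).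
  rewrite L_objective_eq by auto.
  assert (B1 := Bernoulli_sub d u ltac:(lra)). rewrite HDu in B1.
  assert (B2 := Bernoulli_sub (d - 2) u ltac:(lra)).
  rewrite minus_INR in B2 by lia. simpl in B2.
  assert (B3 : 1 - q <= (1 - u) ^ (d - 2)) by lra.
  assert (Hlq : lam * / lam = 1) by (field; lra).
  assert (Hqq : q = / lam * / lam) by (unfold q; field; lra).
  assert (Hli : 0 < / lam) by (apply Rinv_0_lt_compat; lra).
  set (X := 2 * INR d * _).
  (* Here [1 - m^2 = u (2 - u)]; dropping the term with [d - 2] leaves
     [2 q (2 - u) >= 4 q (1 - q)^2]. *)
  assert (HX : 2 * / lam * (1 - q) <= sqrt X).
  { rewrite <- (sqrt_pow2 (2 * / lam * (1 - q))) by nra.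
    apply sqrt_le_1_alt.
    apply Rle_trans with (2 * (INR d * u) * (2 - u)).
    - rewrite HDu. replace ((2 * / lam * (1 - q)) ^ 2) with (4 * q * (1 - q) ^ 2)
        by (rewrite Hqq; ring). nra.
    - unfold X. replace (1 - (1 - u) ^ 2) with (u * (2 - u)) by ring.
      assert (0 <= (INR d - 2) * (u * (2 - u))) by (apply Rmult_le_pos; nra).
      assert (0 <= INR d * u * (2 - u)) by (apply Rmult_le_pos; nra).
      nra. }
  assert (HX0 : 0 <= 2 * / lam * (1 - q)) by nra.
  (* This value equals [lam + (1 - 4 q + 2 q^2) / lam]. *)
  apply Rle_trans with ((1 - q) * lam + (1 - q) * (2 * / lam * (1 - q))).
  - unfold Rdiv at 1. replace (4 / lam ^ 2) with (4 * q) by (unfold q; field; lra).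
    replace ((1 - q) * lam) with (lam - / lam * (lam * / lam))
      by (rewrite Hqq; field; lra).
    rewrite Hlq.
    assert (0 <= / lam * (q * q)) by (apply Rmult_le_pos; nra). nra.
  - apply Rplus_le_compat; [apply Rmult_le_compat_r; lra|].
    apply Rmult_le_compat; lra.
Qed.

Lemma exp_mult_INR (n : nat) (x : R) : exp (INR n * x) = exp x ^ n.
Proof.
  induction n as [|n IH]; [simpl; rewrite Rmult_0_l; apply exp_0|].
  rewrite S_INR, Rmult_plus_distr_r, exp_plus, IH, Rmult_1_l. simpl. ring.
Qed.

(** With [c = n (1 - m^2)], [m^2 <= exp (- (1 - m^2))] gives [m^n <= exp (- c/2)], while
    [(1 + c/4)^2 <= exp (c/2)]. *)
Lemma pow_mul_quadratic_le (n : nat) (m : R) : 0 <= m <= 1 ->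
  m ^ n * (1 + INR n * (1 - m ^ 2) / 4) ^ 2 <= 1.
Proof.
  intros Hm. set (v := 1 - m ^ 2). set (c := INR n * v).
  assert (Hv : 0 <= v) by (unfold v; nra).
  assert (Hc : 0 <= c) by (apply Rmult_le_pos; [apply pos_INR | lra]).
  assert (H1 : m <= exp (- v / 2)).
  { assert (Hp := exp_pos (- v / 2)). assert (Hs := exp_ineq1_le (- v)).
    replace (- v) with (- v / 2 + - v / 2) in Hs at 2 by field.
    rewrite exp_plus in Hs. unfold v in Hs at 1. nra. }
  assert (H2 : m ^ n <= exp (- (c / 2))).
  { apply Rle_trans with (exp (- v / 2) ^ n); [apply pow_incr; lra|].
    rewrite <- exp_mult_INR. right. f_equal. unfold c. field. }
  assert (H3 : (1 + c / 4) ^ 2 <= exp (c / 2)).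
  { replace (c / 2) with (c / 4 + c / 4) by field. rewrite exp_plus.
    assert (Hs := exp_ineq1_le (c / 4)). nra. }
  apply Rle_trans with (exp (- (c / 2)) * exp (c / 2)).
  - apply Rmult_le_compat; try assumption; [apply pow_le; lra | apply pow2_ge_0].
  - rewrite <- exp_plus, Rplus_opp_l, exp_0. lra.
Qed.

Lemma sqrt_mul_le (a b : R) : 0 <= a -> 0 <= b -> sqrt (a * b) <= (a + b) / 2.
Proof.
  intros Ha Hb. rewrite <- (sqrt_pow2 ((a + b) / 2)) by lra.
  apply sqrt_le_1_alt. assert (H := pow2_ge_0 (a - b)). nra.
Qed.

(** The weighted arithmetic-geometric mean inequality makes the root linear in [c = (d-2)(1 - m^2)].
    The weight is chosen so that the term [lam c / 2] matches the linear term of [lam (1 + c/4)^2],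
    a factor which [m^(d-2)] then absorbs. *)
Lemma L_upper (d : nat) (lam e : R) : (3 <= d)%nat -> 0 < lam -> 0 < e ->
  2 <= e * lam ^ 2 -> INR d <= (1 + e / 2) * (INR d - 2) ->
  L d lam <= lam + (1 + e) / lam.
Proof.
  intros Hd Hlam He Hle Hde. apply L_le; auto. intros m Hm.
  rewrite L_objective_eq by auto. assert (HD := INR_ge_3 d Hd).
  assert (HP := pow_mul_quadratic_le (d - 2) m Hm).
  rewrite minus_INR in HP by lia. change (INR 2) with 2 in HP.
  set (v := 1 - m ^ 2) in *. set (D := INR d) in *.
  set (c := (D - 2) * v) in *.
  assert (Hv : 0 <= v <= 1) by (unfold v; nra).
  assert (Hc : 0 <= c) by (apply Rmult_le_pos; lra).
  assert (Hli : 0 < / lam) by (apply Rinv_0_lt_compat; lra).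
  assert (HDv : D * v <= (1 + e / 2) * c).
  { unfold c. assert (H := Rmult_le_compat_r v _ _ (proj1 Hv) Hde). lra. }
  assert (HS : sqrt (2 * D * (v * (1 + c)))
               <= (1 + e / 2) * (1 + c) / lam + lam * c / 2).
  { apply Rle_trans with (sqrt (2 * (1 + e / 2) * (1 + c) / lam * (lam * c))).
    - apply sqrt_le_1_alt.
      replace (2 * (1 + e / 2) * (1 + c) / lam * (lam * c))
        with (2 * (1 + c) * ((1 + e / 2) * c)) by (field; lra).
      replace (2 * D * (v * (1 + c))) with (2 * (1 + c) * (D * v)) by ring.
      apply Rmult_le_compat_l; lra.
    - eapply Rle_trans; [apply sqrt_mul_le|].
      + apply Rmult_le_pos; nra.
      + nra.
      + right. field. lra. }
  assert (Hp : 0 <= m ^ (d - 2)) by (apply pow_le; lra).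
  assert (Hmd : m ^ d <= m ^ (d - 2)).
  { replace d with (2 + (d - 2))%nat at 1 by lia. rewrite pow_add.
    unfold v in Hv. nra. }
  set (p := m ^ (d - 2)) in *.
  assert (HB : lam + ((1 + e / 2) * (1 + c) / lam + lam * c / 2)
               <= (lam + (1 + e) / lam) * (1 + c / 4) ^ 2).
  { apply Rmult_le_reg_l with lam; auto.
    replace (lam * (lam + ((1 + e / 2) * (1 + c) / lam + lam * c / 2)))
      with (lam ^ 2 * (1 + c / 2) + (1 + e / 2) * (1 + c)) by (field; lra).
    replace (lam * ((lam + (1 + e) / lam) * (1 + c / 4) ^ 2))
      with ((lam ^ 2 + 1 + e) * (1 + c / 2 + c ^ 2 / 16)) by (field; lra).
    (* What is left after cancellation, times [e], is at least [(c - 2 e)^2 / 8], because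
       [e lam^2 >= 2]. *)
    assert (H8 : 0 <= e * (e / 2 - c / 2 + lam ^ 2 * c ^ 2 / 16)).
    { assert (H9 : 2 * c ^ 2 <= e * lam ^ 2 * c ^ 2)
        by (apply Rmult_le_compat_r; [apply pow2_ge_0 | lra]).
      assert (H10 := pow2_ge_0 (c - 2 * e)). nra. }
    assert (0 <= e / 2 - c / 2 + lam ^ 2 * c ^ 2 / 16) by nra.
    assert (0 <= (1 + e) * c ^ 2) by (apply Rmult_le_pos; [lra | apply pow2_ge_0]).
    nra. }
  assert (H0 : 0 <= lam + (1 + e) / lam)
    by (apply Rplus_le_le_0_compat; [lra | apply Rmult_le_pos; lra]).
  apply Rle_trans with (p * (lam + ((1 + e / 2) * (1 + c) / lam + lam * c / 2))).
  - rewrite (Rmult_plus_distr_l p).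
    apply Rplus_le_compat; [apply Rmult_le_compat_r|apply Rmult_le_compat_l]; lra.
  - apply Rle_trans with (p * ((lam + (1 + e) / lam) * (1 + c / 4) ^ 2));
      [apply Rmult_le_compat_l; lra|].
    replace (p * ((lam + (1 + e) / lam) * (1 + c / 4) ^ 2))
      with ((lam + (1 + e) / lam) * (p * (1 + c / 4) ^ 2)) by ring.
    rewrite <- (Rmult_1_r (lam + (1 + e) / lam)) at 2.
    apply Rmult_le_compat_l; auto.
Qed.

Lemma real_Glb_Rbar_between (E : R -> Prop) (a b : R) :
  E b -> (forall x, E x -> a <= x) -> a <= real (Glb_Rbar E) <= b.
Proof.
  intros Hb Ha. destruct (Glb_Rbar_correct E) as [H1 H2].
  specialize (H1 b Hb). assert (H3 := H2 a Ha).
  destruct (Glb_Rbar E); simpl in *; lra.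
Qed.

Lemma real_Lub_Rbar_between (E : R -> Prop) (a b : R) :
  E a -> (forall x, E x -> x <= b) -> a <= real (Lub_Rbar E) <= b.
Proof.
  intros Ha Hb. destruct (Lub_Rbar_correct E) as [H1 H2].
  specialize (H1 a Ha). assert (H3 := H2 b Hb).
  destruct (Lub_Rbar E); simpl in *; lra.
Qed.

(** Since [(lam + r / lam)^2 = lam^2 + 2 r + (r / lam)^2] with [r] near 1, [L] crosses the level
    [mu] near [lam^2 = mu^2 - 2]. The trial points [a] and [b] lie below and above the crossing. *)
Lemma Lambda_sph_between (d : nat) (e : R) : (3 <= d)%nat -> 0 < e ->
  INR d <= (1 + e / 2) * (INR d - 2) -> 0 <= mu d ->
  3 + 4 * e + 2 / e + (1 + e) ^ 2 / e < mu d ^ 2 ->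
  mu d ^ 2 - 2 - 4 * e <= Lambda_sph d ^ 2 <= mu d ^ 2 - 2 + 4 * e.
Proof.
  intros Hd He Hde Hmu HM.
  assert (P1 : 0 < 2 / e) by (apply Rdiv_lt_0_compat; lra).
  assert (P2 : 0 < (1 + e) ^ 2 / e) by (apply Rdiv_lt_0_compat; nra).
  assert (E1 : 2 / e * e = 2) by (field; lra).
  assert (E2 : (1 + e) ^ 2 / e * e = (1 + e) ^ 2) by (field; lra).
  set (a := sqrt (mu d ^ 2 - 2 - 4 * e)).
  set (b := sqrt (mu d ^ 2 - 2 + 4 * e)).
  assert (Ha2 : a ^ 2 = mu d ^ 2 - 2 - 4 * e) by (apply pow2_sqrt; lra).
  assert (Hb2 : b ^ 2 = mu d ^ 2 - 2 + 4 * e) by (apply pow2_sqrt; lra).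
  assert (Ha : 1 <= a) by (rewrite <- sqrt_1; apply sqrt_le_1_alt; lra).
  assert (Hb : 1 <= b) by (rewrite <- sqrt_1; apply sqrt_le_1_alt; lra).
  assert (Hab : a <= Lambda_sph d <= b).
  { apply real_Glb_Rbar_between.
    - split; [lra|].
      apply Rlt_gt, Rlt_le_trans with (2 := L_lower d b Hd Hb).
      assert (Hq : 4 / b ^ 2 < 2 * e).
      { apply Rlt_div_l; nra. }
      assert (Hbi : b * / b = 1) by (field; lra).
      assert (Hbp : 0 < / b) by (apply Rinv_0_lt_compat; lra).
      set (r := 1 - 4 / b ^ 2) in *.
      assert (Hr : mu d ^ 2 < (b + r / b) ^ 2).
      { replace ((b + r / b) ^ 2) with (b ^ 2 + 2 * r + (r / b) ^ 2)
          by (field; lra).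
        assert (H := pow2_ge_0 (r / b)). unfold r in *. lra. }
      assert (Hrb : 0 <= b + r / b).
      { replace (b + r / b) with ((b ^ 2 + r) * / b) by (field; lra).
        apply Rmult_le_pos; [|lra]. unfold r. lra. }
      nra.
    (* If [lam < a], monotonicity would give [L d lam <= L d a <= mu d]. *)
    - intros lam [Hl0 Hl]. destruct (Rle_lt_dec a lam) as [|Hlt]; auto.
      exfalso. assert (Hi := L_increasing d lam a Hd ltac:(lra)).
      assert (Hu := L_upper d a e Hd ltac:(lra) He ltac:(nra) Hde).
      assert (Hai : 0 < / a) by (apply Rinv_0_lt_compat; lra).
      assert (Hr : (a + (1 + e) / a) ^ 2 <= mu d ^ 2).
      { replace ((a + (1 + e) / a) ^ 2)
          with (a ^ 2 + 2 * (1 + e) + (1 + e) ^ 2 / a ^ 2) by (field; lra).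
        assert ((1 + e) ^ 2 / a ^ 2 <= e) by (apply Rle_div_l; nra). lra. }
      assert (0 < (1 + e) / a) by (apply Rmult_lt_0_compat; lra).
      nra. }
  rewrite <- Ha2, <- Hb2. split; apply pow_incr; lra.
Qed.

Lemma Lambda_sph_sub_mu :
  is_lim_seq (fun d => Lambda_sph d ^ 2 - (mu d ^ 2 - 2)) 0.
Proof.
  destruct mu_asymptotics as [HA Hpos].
  assert (Hmu : is_lim_seq (fun d => mu d ^ 2) p_infty).
  { apply is_lim_seq_ext with (fun d =>
      (mu d ^ 2 - (2 * ln (INR d) + 2 * ln (ln (INR d)) + 2))
      + (2 * ln (INR d) + 2 * ln (ln (INR d)) + 2)); [intros; ring|].
    apply is_lim_seq_plus with 0 p_infty; auto; [|reflexivity].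
    assert (HL := is_lim_seq_ln_INR).
    assert (HLL := is_lim_seq_comp_p _ _ _ is_lim_ln_p HL).
    apply is_lim_seq_le_p_loc with (fun d => ln (INR d)); auto.
    generalize (filter_and _ _ (eventually_ge_lim_p _ 0 HL)
                  (eventually_ge_lim_p _ 0 HLL)).
    apply filter_imp. intros d [H1 H2]. lra. }
  apply is_lim_seq_squeeze_eps. intros e He.
  set (e' := e / 4). assert (He' : 0 < e') by (unfold e'; lra).
  assert (H3 : eventually (fun d => (3 <= d)%nat)) by (exists 3%nat; auto).
  generalize (filter_and _ _ H3 (filter_and _ _ Hpos
    (* The bound [d > 2 + 4 / e'] yields [d <= (1 + e'/2)(d - 2)]. *)
    (filter_and _ _ (eventually_ge_lim_p _ (2 + 4 / e') is_lim_seq_INR)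
      (eventually_ge_lim_p _ (3 + 4 * e' + 2 / e' + (1 + e') ^ 2 / e') Hmu)))).
  apply filter_imp. intros d [Hd [H0 [HD HM]]].
  replace e with (4 * e') by (unfold e'; field).
  apply Lambda_sph_between; auto.
  assert (4 / e' * e' = 4) by (field; lra). nra.
Qed.

(** * The threshold [lambda_sph] *)

Lemma ln_le_sub_1 (x : R) : 0 < x -> ln x <= x - 1.
Proof.
  intros Hx. assert (H := exp_ineq1_le (ln x)). rewrite exp_ln in H; lra.
Qed.

(** Used with [p = t^d] and [y = ln (1 - t^2)]: dividing by the positive factor [p / (2 (1 + p))]
    isolates [lam^2]. *)
Lemma lambda_condition_iff (lam p y : R) : 0 < p ->
  lam ^ 2 / 2 * (p / (1 + p)) <= - (1 / 2) * y <-> lam ^ 2 <= - y * (1 + / p).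
Proof.
  intros Hp. assert (H0 : 0 < p / (2 * (1 + p))) by (apply Rdiv_lt_0_compat; lra).
  replace (lam ^ 2 / 2 * (p / (1 + p))) with (p / (2 * (1 + p)) * lam ^ 2)
    by (field; lra).
  replace (- (1 / 2) * y) with (p / (2 * (1 + p)) * (- y * (1 + / p)))
    by (field; lra).
  split; intros H; [apply Rmult_le_reg_l in H | apply Rmult_le_compat_l]; lra.
Qed.

(** From [ln (t^2) <= t^2 - 1], the exponent in [t^(-d) = exp (- d ln t)] is at least
    [d (1 - t^2) / 2]. *)
Lemma inv_pow_ge (d : nat) (t : R) : 0 < t ->
  1 + INR d / 2 * (1 - t ^ 2) <= / t ^ d.
Proof.
  intros Ht. assert (Hn := ln_le_sub_1 (t ^ 2) ltac:(nra)).
  rewrite ln_pow in Hn by lra. change (INR 2) with 2 in Hn.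
  rewrite <- (exp_ln t Ht) at 2.
  rewrite <- exp_mult_INR, <- exp_Ropp.
  eapply Rle_trans; [|apply exp_ineq1_le].
  assert (0 <= INR d) by apply pos_INR. nra.
Qed.

(* The scale [c = d (1 - t^2)] is split at [k / sqrt (ln d)], [8] and [sqrt d].
   In the first range the bound on [- ln w] is the tangent at the asymptotic
   minimizer [w = 4 / (d ln d)]. *)
Lemma lambda_lower_pointwise (d : nat) (k t : R) : (3 <= d)%nat -> 0 < k ->
  0 < t < 1 ->
  let l := ln (INR d) in
  1 < l ->
  1 <= ln l ->
  2 * ln l + 2 <= l ->
  l <= / 6 * sqrt (INR d) ->
  2 * ln l + 2 + 2 * ln 8 + ln 8 * k / (2 * sqrt l) <= k * sqrt l / 2 ->
  2 * l + 2 * ln l + 2 - 4 * ln 2 - k ^ 2 / 8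
    <= - ln (1 - t ^ 2) * (1 + / t ^ d).
Proof.
  intros Hd Hk Ht l Hl1 Hll Hl2 Hl3 Hl4.
  assert (HD := INR_ge_3 d Hd). set (D := INR d) in *.
  assert (Hp := inv_pow_ge d t ltac:(lra)). fold D in Hp.
  set (w := 1 - t ^ 2) in *.
  assert (Hw : 0 < w < 1) by (unfold w; nra).
  assert (Hnw : w + ln (1 - w) <= 0) by (assert (H := ln_le_sub_1 (1 - w) ltac:(lra)); lra).
  assert (Hlw : ln w < 0) by (rewrite <- ln_1; apply ln_increasing; lra).
  assert (Hln2 : 0 < ln 2) by (rewrite <- ln_1; apply ln_increasing; lra).
  assert (Hln8 : ln 8 = 3 * ln 2).
  { replace 8 with (2 ^ 3) by ring. rewrite ln_pow by lra. simpl. ring. }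
  assert (Hsl : 0 < sqrt l) by (apply sqrt_lt_R0; lra).
  assert (Hsl2 : sqrt l * sqrt l = l) by (apply sqrt_sqrt; lra).
  assert (HsD : 0 < sqrt D) by (apply sqrt_lt_R0; lra).
  assert (HsD2 : sqrt D * sqrt D = D) by (apply sqrt_sqrt; lra).
  assert (Hk2 : 0 < k ^ 2) by nra.
  set (c := D * w).
  assert (Hc : 0 < c) by (apply Rmult_lt_0_compat; lra).
  assert (Hwc : ln w = ln c - l).
  { unfold c, l. rewrite ln_mult by lra. ring. }
  assert (Hh : - ln w * (2 + c / 2) <= - ln w * (1 + / t ^ d)).
  { apply Rmult_le_compat_l; [lra|]. unfold c. lra. }
  destruct (Rle_lt_dec c (k / sqrt l)) as [H1|H1].
  { apply Rle_trans with (2 := Hh).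
    assert (Htan : ln c <= ln 4 - ln l + (c * l / 4 - 1)).
    { assert (H := ln_le_sub_1 (c * l / 4) ltac:(nra)).
      rewrite ln_div, ln_mult in H by nra. lra. }
    assert (Hln4 : ln 4 = 2 * ln 2).
    { replace 4 with (2 ^ 2) by ring. rewrite ln_pow by lra. simpl. ring. }
    assert (Hln2' : ln 2 <= 1) by (assert (H := ln_le_sub_1 2 ltac:(lra)); lra).
    assert (Hcl : c ^ 2 * l <= k ^ 2).
    { assert (H : c * sqrt l <= k) by (apply Rle_div_r in H1; lra).
      replace (c ^ 2 * l) with ((c * sqrt l) ^ 2)
        by (rewrite <- Hsl2 at 2; ring).
      apply pow_incr. split; [nra | exact H]. }
    (* In this product the terms in [c l] cancel; the only loss is [c^2 l / 8 <= k^2 / 8]. *)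
    apply Rle_trans with ((l + ln l - 2 * ln 2 + 1 - c * l / 4) * (2 + c / 2));
      [|apply Rmult_le_compat_r; lra].
    assert (0 <= c * (ln l + 1 - 2 * ln 2)) by (apply Rmult_le_pos; lra).
    nra. }
  destruct (Rle_lt_dec c 8) as [H2|H2].
  { apply Rle_trans with (2 := Hh).
    assert (Hc8 : ln c <= ln 8) by (apply ln_le; lra).
    (* Here [- ln w] loses only a constant, while [c > k / sqrt l] gains [k sqrt l / 2], which
       outweighs [2 ln l]. *)
    apply Rle_trans with ((l - ln 8) * (2 + k / sqrt l / 2)).
    - replace ((l - ln 8) * (2 + k / sqrt l / 2))
        with (2 * l - 2 * ln 8 + k * (sqrt l * sqrt l) / sqrt l / 2 - ln 8 * k / (2 * sqrt l))
        by (rewrite Hsl2; field; lra).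
      replace (k * (sqrt l * sqrt l) / sqrt l / 2) with (k * sqrt l / 2) by (field; lra).
      lra.
    - assert (0 < k / sqrt l) by (apply Rdiv_lt_0_compat; lra).
      apply Rle_trans with (- ln w * (2 + k / sqrt l / 2));
        [apply Rmult_le_compat_r; lra | apply Rmult_le_compat_l; lra]. }
  (* The target is at most [3 l]. For [8 < c <= sqrt d] the factors are at least [l / 2] and [6]. *)
  apply Rle_trans with (3 * l); [lra|].
  destruct (Rle_lt_dec c (sqrt D)) as [H3|H3].
  { apply Rle_trans with (2 := Hh).
    assert (Hcs : ln c <= l / 2).
    { apply Rle_trans with (ln (sqrt D)); [apply ln_le; lra|].
      right. unfold l. rewrite <- HsD2 at 2. rewrite ln_mult by lra. field. }
    nra. }
  (* Now [w] may be near 1 and [- ln w] small; [- ln w >= 1 - w = t^2] costs two powers of [t], and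
     [t^(-(d-2)) >= c / 2 > sqrt d / 2 >= 3 l]. *)
  assert (Hp' := inv_pow_ge (d - 2) t ltac:(lra)).
  rewrite minus_INR in Hp' by lia. change (INR 2) with 2 in Hp'. fold D w in Hp'.
  assert (Hq : / t ^ (d - 2) = t ^ 2 * / t ^ d).
  { replace (t ^ d) with (t ^ 2 * t ^ (d - 2)) by (rewrite <- pow_add; f_equal; lia).
    assert (0 < t ^ (d - 2)) by (apply pow_lt; lra). field. split; lra. }
  assert (Hlt : t ^ 2 <= - ln w).
  { assert (H := ln_le_sub_1 w ltac:(lra)). unfold w at 2 in H. lra. }
  assert (Hpi : 0 < / t ^ d) by (apply Rinv_0_lt_compat, pow_lt; lra).
  apply Rle_trans with (t ^ 2 * / t ^ d).
  - rewrite <- Hq. unfold c in H3. lra.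
  - apply Rmult_le_compat; try lra. nra.
Qed.

(** The choice [t = exp (- w/2)] makes [t^(-d) = exp (2/l)] exact, and
    [1 - t^2 = 1 - exp (- w) >= w / (1 + w)] costs at most [ln (1 + w) <= w]. *)
Lemma lambda_upper_pointwise (d : nat) : (3 <= d)%nat ->
  let l := ln (INR d) in
  let w := 4 / (INR d * l) in
  0 < l ->
  exists t, 0 < t < 1 /\
    - ln (1 - t ^ 2) * (1 + / t ^ d)
      <= (l + ln l - 2 * ln 2 + w) * (1 + exp (2 / l)).
Proof.
  intros Hd l w Hl. assert (HD := INR_ge_3 d Hd). fold l in Hl.
  assert (Hw : 0 < w) by (apply Rdiv_lt_0_compat; nra).
  exists (exp (- w / 2)). split.
  { split; [apply exp_pos|]. rewrite <- exp_0. apply exp_increasing. lra. }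
  assert (E1 : exp (- w / 2) ^ d = exp (- (2 / l))).
  { rewrite <- exp_mult_INR. f_equal. unfold w. field. lra. }
  assert (E2 : exp (- w / 2) ^ 2 = / exp w).
  { rewrite <- exp_mult_INR, <- exp_Ropp. f_equal. simpl. field. }
  rewrite E1, E2, <- (exp_Ropp (- (2 / l))), Ropp_involutive.
  assert (Hln4 : ln 4 = 2 * ln 2).
  { replace 4 with (2 ^ 2) by ring. rewrite ln_pow by lra. simpl. ring. }
  assert (Hew := exp_ineq1_le w).
  apply Rmult_le_compat_r; [assert (H := exp_pos (2 / l)); lra|].
  assert (H1 : ln (w / (1 + w)) <= ln (1 - / exp w)).
  { apply ln_le; [apply Rdiv_lt_0_compat; lra|].
    replace (w / (1 + w)) with (1 - / (1 + w)) by (field; lra).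
    assert (/ exp w <= / (1 + w)) by (apply Rinv_le_contravar; lra). lra. }
  rewrite ln_div in H1 by lra.
  assert (H2 := ln_le_sub_1 (1 + w) ltac:(lra)).
  unfold w in H1 at 1. rewrite ln_div, ln_mult in H1 by nra. fold l in H1. lra.
Qed.

Lemma lambda_sph_between (d : nat) (a b : R) : (3 <= d)%nat -> 0 <= a ->
  (forall t, 0 < t < 1 -> a <= - ln (1 - t ^ 2) * (1 + / t ^ d)) ->
  (exists t, 0 < t < 1 /\ - ln (1 - t ^ 2) * (1 + / t ^ d) <= b) ->
  a <= lambda_sph d ^ 2 <= b.
Proof.
  intros Hd Ha Hlow [t0 [Ht0 Hb]].
  assert (Hab : a <= b) by (apply Rle_trans with (2 := Hb); auto).
  assert (H : sqrt a <= lambda_sph d <= sqrt b).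
  { apply real_Lub_Rbar_between.
    (* At [t = 0] the inverse power is meaningless, but the original condition reads [0 <= 0]. *)
    - intros t Ht. destruct (Req_dec t 0) as [->|Ht'].
      + rewrite !pow_i by lia. replace (1 - 0) with 1 by ring.
        rewrite ln_1. lra.
      + apply lambda_condition_iff; [apply pow_lt; lra|].
        rewrite pow2_sqrt by lra. apply Hlow. lra.
    - intros x Hx.
      assert (H := Hx t0 ltac:(lra)).
      apply lambda_condition_iff in H; [|apply pow_lt; lra].
      (* The sign of [x] is unrestricted, so only [sqrt b >= 0] is invoked. *)
      apply Rsqr_incr_0_var; [|apply sqrt_pos].
      rewrite Rsqr_sqrt by lra. unfold Rsqr. lra. }
  assert (H0 := sqrt_pos a).
  rewrite <- (pow2_sqrt a), <- (pow2_sqrt b) by lra.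
  split; apply pow_incr; lra.
Qed.

(** Bounding [exp (2/l)] by [l / (l - 2)] turns the product into [2 A + 2 A / (l - 2)] with
    [A = l + ...]; the quotient is [2] plus a remainder of order [ln l / l]. *)
Lemma lambda_upper_simplified (D l e : R) : 0 < e -> 3 <= D -> 4 < l ->
  40 / e + 4 <= l -> ln l <= e / 8 * l ->
  (l + ln l - 2 * ln 2 + 4 / (D * l)) * (1 + exp (2 / l))
    <= 2 * l + 2 * ln l + 2 - 4 * ln 2 + e.
Proof.
  intros He HD Hl Hle Hln.
  set (w := 4 / (D * l)).
  assert (Hel : 40 + 4 * e <= e * l).
  { replace (40 + 4 * e) with (e * (40 / e + 4)) by (field; lra).
    apply Rmult_le_compat_l; lra. }
  assert (Hw : 0 < w) by (apply Rdiv_lt_0_compat; nra).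
  assert (Hw1 : w <= 1) by (apply Rle_div_l; nra).
  assert (Hw2 : w <= e / 4) by (apply Rle_div_l; nra).
  assert (Hln2 : 0 < ln 2) by (rewrite <- ln_1; apply ln_increasing; lra).
  assert (Hln2' : ln 2 <= 1) by (assert (H := ln_le_sub_1 2 ltac:(lra)); lra).
  assert (Hll : 0 <= ln l) by (rewrite <- ln_1; apply ln_le; lra).
  assert (Hexp : exp (2 / l) <= l / (l - 2)).
  { assert (H := exp_ineq1_le (- (2 / l))).
    rewrite exp_Ropp in H.
    rewrite <- (Rinv_inv (exp (2 / l))).
    replace (l / (l - 2)) with (/ (1 + - (2 / l))) by (field; lra).
    apply Rinv_le_contravar; auto.
    assert (2 / l < 1) by (apply Rlt_div_l; lra). lra. }
  assert (HA : 0 <= l + ln l - 2 * ln 2 + w) by lra.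
  apply Rle_trans with ((l + ln l - 2 * ln 2 + w) * (1 + l / (l - 2)));
    [apply Rmult_le_compat_l; lra|].
  replace ((l + ln l - 2 * ln 2 + w) * (1 + l / (l - 2)))
    with (2 * (l + ln l - 2 * ln 2 + w) + 2
          + 2 * (2 + ln l - 2 * ln 2 + w) / (l - 2)) by (field; lra).
  assert (2 * (2 + ln l - 2 * ln 2 + w) / (l - 2) <= e / 2)
    by (apply Rle_div_l; nra).
  lra.
Qed.

Lemma lambda_sph_asymptotics :
  is_lim_seq (fun d : nat => lambda_sph d ^ 2
      - (2 * ln (INR d) + 2 * ln (ln (INR d)) + 2 - 4 * ln 2)) 0.
Proof.
  apply is_lim_seq_squeeze_eps. intros e He.
  (* Makes the loss [k^2 / 8] of the lower bound equal to [e]. *)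
  set (k := sqrt (8 * e)).
  assert (Hk : 0 < k) by (apply sqrt_lt_R0; lra).
  assert (Hk2 : k ^ 2 = 8 * e) by (apply pow2_sqrt; lra).
  assert (HL := is_lim_seq_ln_INR).
  assert (HLL := is_lim_seq_comp_p _ _ _ is_lim_ln_p HL).
  assert (HS := is_lim_seq_comp_p sqrt _ p_infty filterlim_sqrt_p HL).
  assert (HSD := is_lim_seq_comp_p sqrt _ p_infty filterlim_sqrt_p is_lim_seq_INR).
  assert (Hd3 : eventually (fun d => (3 <= d)%nat)) by (exists 3%nat; auto).
  assert (He8 : 0 < e / 8) by lra. assert (Hk16 : 0 < k / 16) by lra.
  assert (Hi4 : 0 < / 4) by lra. assert (Hi12 : 0 < / 12) by lra.
  generalize (filter_and _ _ Hd3 (filter_and _ _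
    (eventually_ge_lim_p _ (40 / e + 4 + e) HL) (filter_and _ _
    (eventually_ge_lim_p _ 1 HLL) (filter_and _ _
    (ln_le_eventually_seq _ _ He8 HL) (filter_and _ _
    (ln_le_eventually_seq _ _ Hi4 HL) (filter_and _ _
    (ln_le_eventually_seq _ _ Hi12 HSD) (filter_and _ _
    (ln_le_eventually_seq _ _ Hk16 HS)
    (eventually_ge_lim_p _ (1 + 4 / k * (2 + 2 * ln 8 + ln 8 * k / 2)) HS)))))))).
  apply filter_imp. intros d [Hd [H1 [H2 [H3 [H4 [H5 [H6 H7]]]]]]].
  assert (HD := INR_ge_3 d Hd).
  assert (0 < 40 / e) by (apply Rdiv_lt_0_compat; lra).
  set (l := ln (INR d)) in *.
  assert (Hln2 : 0 < ln 2) by (rewrite <- ln_1; apply ln_increasing; lra).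
  assert (Hln2' : ln 2 <= 1) by (assert (H' := ln_le_sub_1 2 ltac:(lra)); lra).
  assert (Hln8 : 0 < ln 8) by (rewrite <- ln_1; apply ln_increasing; lra).
  apply lambda_sph_between; auto.
  - lra.
  - intros t Ht. replace e with (k ^ 2 / 8) by lra.
    apply lambda_lower_pointwise; auto; fold l; try lra.
    (* As [l = 2 ln (sqrt d)], the rate [/ 12] for [sqrt d] gives [l <= sqrt d / 6]. *)
    + unfold l at 1. rewrite <- (sqrt_sqrt (INR d)) by lra.
      assert (0 < sqrt (INR d)) by (apply sqrt_lt_R0; lra).
      rewrite ln_mult by lra. rewrite sqrt_sqrt by lra. lra.
    (* The budget [k sqrt l / 2] is halved: one half pays for [2 ln l = 4 ln (sqrt l)], the other
       for the remaining terms. *)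
    + assert (Hp : 0 < 4 / k * (2 + 2 * ln 8 + ln 8 * k / 2)).
      { apply Rmult_lt_0_compat; [apply Rdiv_lt_0_compat; lra | nra]. }
      assert (E : ln l = 2 * ln (sqrt l)).
      { rewrite <- (sqrt_sqrt l) at 1 by lra. rewrite ln_mult by lra. ring. }
      assert (Hb : 2 + 2 * ln 8 + ln 8 * k / 2 <= k * sqrt l / 4).
      { replace (2 + 2 * ln 8 + ln 8 * k / 2)
          with (k / 4 * (4 / k * (2 + 2 * ln 8 + ln 8 * k / 2))) by (field; lra).
        nra. }
      assert (ln 8 * k / (2 * sqrt l) <= ln 8 * k / 2).
      { apply Rle_div_l; [lra|].
        assert (0 < ln 8 * k) by (apply Rmult_lt_0_compat; lra). nra. }
      lra.
  - assert (Hl0 : 0 < l) by lra.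
    destruct (lambda_upper_pointwise d Hd Hl0) as [t [Ht H']].
    exists t. split; auto. apply Rle_trans with (1 := H').
    apply lambda_upper_simplified; fold l; lra.
Qed.

Theorem mainTheorem5 :
  is_lim_seq (fun d : nat =>
    mu d ^ 2 - (2 * ln (INR d) + 2 * ln (ln (INR d)) + 2)) 0
  /\ is_lim_seq (fun d : nat =>
    Lambda_sph d ^ 2 - (2 * ln (INR d) + 2 * ln (ln (INR d)))) 0
  /\ is_lim_seq (fun d : nat =>
    lambda_sph d ^ 2
      - (2 * ln (INR d) + 2 * ln (ln (INR d)) + 2 - 4 * ln 2)) 0.
Proof.
  destruct mu_asymptotics as [Hmu _].
  split; [exact Hmu|]. split; [|exact lambda_sph_asymptotics].
  apply is_lim_seq_ext with (fun d => (Lambda_sph d ^ 2 - (mu d ^ 2 - 2))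
    + (mu d ^ 2 - (2 * ln (INR d) + 2 * ln (ln (INR d)) + 2))); [intros; ring|].
  replace (Finite 0) with (Finite (0 + 0)) by (f_equal; ring).
  apply is_lim_seq_plus'; [exact Lambda_sph_sub_mu | exact Hmu].
Qed.
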